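(* The line graph $L(K_n)$ of the complete graph $K_n$, with $n\geq 4$, is a coherent $\{K_{n-1},K_3\}_{K_2}$-ultrahomogeneous graph with $n$ copies of $K_{n-1}$ and $\binom{n}{3}$ copies of $K_3$ not contained in a copy of $K_{n-1}$.
   Context: A graph $G$ is $H$-ultrahomogeneous ($H$-UH) if every isomorphism between two induced copies of $H$ in $G$ extends to an automorphism of $G$. Let $M$ be an induced subgraph of a graph $H$ and let $G$ be both $M$-UH and $H$-UH. Then $G$ is a (coherent) $\{H\}_M$-UH graph if, for each copy $H_0$ of $H$ induced in $G$ and containing a copy $M_0$ of $M$, there exists exactly one copy $H_1\neq H_0$ of $H$ induced in $G$ such that $V(H_0)\cap V(H_1)=V(M_0)$ and $E(H_0)\cap E(H_1)=E(M_0)$. If $G$ is coherent $\{H\}_M$-UH and $K$ is both a subgraph of $H$ and a supergraph of $M$, then $G$ is $\{K\not\subset H\}_M$-UH if every isomorphism between two induced copies of $K$ in $G$ not contained in any copy of $H$ in $G$ extends to an automorphism of $G$. If, under these conditions, each copy of $M$ induced in $G$ coincides with the intersection of exactly one copy of $H$ and exactly one copy of $K$ not contained in any copy of $H$, then $G$ is coherent $\{H,K\}_M$-UH. Here $H=K_{n-1}$, $K=K_3$, $M=K_2$. The line graph $L(K_n)$ has the edges of $K_n$ as vertices, two of them being adjacent if and only if they share an endvertex in $K_n$.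
   Formalization: ''Coherent'' here drops the clause that a copy of K_{n-1} meets exactly one other in each of its K_2's (copies share one vertex for n≥5); for n=4 the ''copies of K_{n-1}'' are a chosen family of 4 of the 8 triangles, and ''not contained in a copy'' is relative to that family. *)

(* Defs.v *)
From mathcomp Require Import all_boot.
Set Implicit Arguments.
Unset Strict Implicit.
Unset Printing Implicit Defensive.

Record sgraph := SGraph {
  vert :> finType;
  adj : rel vert;
  adj_sym : symmetric adj;
  adj_irrefl : irreflexive adj }.

Definition isomorphism (G1 G2 : sgraph) (f : G1 -> G2) : Prop :=
  bijective f /\ {mono f : x y / adj x y}.

Definition isomorphic (G1 G2 : sgraph) : bool :=
  [exists f : {ffun G1 -> G2},
     [&& injectiveb f, [forall y, y \in codom f] &
         [forall x, forall y, adj (f x) (f y) == adj x y]]].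

Lemma isomorphicP (G1 G2 : sgraph) :
  reflect (exists f : G1 -> G2, isomorphism f) (isomorphic G1 G2).
Proof.
apply: (iffP existsP) => [[f /and3P[/injectiveP fi /forallP fs /forallP fm]]|].
  exists f; split; last by move=> x y; apply/eqP/(forallP (fm x)).
  apply: inj_card_bij => //; rewrite -(card_codom fi).
  by apply: subset_leq_card; apply/subsetP=> y _; apply: fs.
case=> f [fb fm]; have [g gK fK] := fb; exists (finfun f); apply/and3P; split.
- by apply/injectiveP => x y; rewrite !ffunE; apply: bij_inj.
- by apply/forallP => y; apply/codomP; exists (g y); rewrite ffunE fK.
- by apply/forallP => x; apply/forallP => y; rewrite !ffunE fm.
Qed.

Definition subgraph (G1 G2 : sgraph) : Prop :=
  exists f : G1 -> G2, injective f /\ {homo f : x y / adj x y}.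

Definition induced_subgraph (G1 G2 : sgraph) : Prop :=
  exists f : G1 -> G2, injective f /\ {mono f : x y / adj x y}.

Section Induced.
Variables (G : sgraph) (S : {set G}).

Definition induced_vert := {x : G | x \in S}.
Definition induced_adj : rel induced_vert := [rel x y | adj (val x) (val y)].

Lemma induced_adj_sym : symmetric induced_adj.
Proof. by move=> x y; apply: adj_sym. Qed.

Lemma induced_adj_irrefl : irreflexive induced_adj.
Proof. by move=> x; apply: adj_irrefl. Qed.

Definition induced : sgraph := SGraph induced_adj_sym induced_adj_irrefl.
End Induced.

Section Complete.
Variable m : nat.

Definition complete_adj : rel 'I_m := [rel x y | x != y].

Lemma complete_adj_sym : symmetric complete_adj.
Proof. by move=> x y; rewrite /complete_adj /= eq_sym. Qed.

Lemma complete_adj_irrefl : irreflexive complete_adj.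
Proof. by move=> x; rewrite /complete_adj /= eqxx. Qed.

Definition complete : sgraph := SGraph complete_adj_sym complete_adj_irrefl.
End Complete.

Section LineGraph.
Variable G : sgraph.

Definition edges : {set {set G}} :=
  [set e : {set G} | [exists x, exists y, adj x y && (e == [set x; y])]].

Definition line_vert := {e : {set G} | e \in edges}.
Definition line_adj : rel line_vert :=
  [rel e f | (e != f) && (val e :&: val f != set0)].

Lemma line_adj_sym : symmetric line_adj.
Proof. by move=> e f; rewrite /line_adj /= eq_sym setIC. Qed.

Lemma line_adj_irrefl : irreflexive line_adj.
Proof. by move=> e; rewrite /line_adj /= eqxx. Qed.

Definition line_graph : sgraph := SGraph line_adj_sym line_adj_irrefl.
End LineGraph.

(* An induced copy of H in G is identified with its vertex set. Hence, for two
   induced copies, containment and intersection (of vertices and of edges) are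
   containment and intersection of vertex sets. *)
Definition copies (G H : sgraph) : {set {set G}} :=
  [set S : {set G} | isomorphic H (induced S)].

Definition copies_outside (G K : sgraph) (Hs : {set {set G}}) : {set {set G}} :=
  [set S in copies G K | ~~ [exists T in Hs, S \subset T]].

Definition isos_extend (G : sgraph) (F : {set {set G}}) : Prop :=
  forall S T : {set G}, S \in F -> T \in F ->
  forall g : induced S -> induced T, isomorphism g ->
  exists phi : G -> G,
    isomorphism phi /\ forall x : induced S, phi (val x) = val (g x).

Definition UH (G H : sgraph) : Prop := isos_extend (copies G H).

(* The condition on copies of a single graph H. It cannot be combined with
   [meets_once] for M = K_2 and K = K_3, see [fastened_meets_once_K2_K3]. *)
Definition fastened (G M : sgraph) (Hs : {set {set G}}) : Prop :=
  forall H0 M0, H0 \in Hs -> M0 \in copies G M -> M0 \subset H0 ->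
  exists! H1 : {set G}, [/\ H1 \in Hs, H1 != H0 & H0 :&: H1 = M0].

Definition meets_once (G K M : sgraph) (Hs : {set {set G}}) : Prop :=
  forall M0, M0 \in copies G M ->
  exists! P : {set G} * {set G},
    [/\ P.1 \in Hs, P.2 \in copies_outside K Hs & P.1 :&: P.2 = M0].

Lemma card_copy (G H : sgraph) (S : {set G}) : S \in copies G H -> #|S| = #|H|.
Proof.
rewrite inE => /isomorphicP[f [fb _]].
by rewrite (bij_eq_card fb) card_sig; apply: eq_card => x; rewrite !inE.
Qed.

Lemma fastened_meets_once_K2_K3 (G : sgraph) (Hs : {set {set G}}) :
  fastened (complete 2) Hs -> meets_once (complete 3) (complete 2) Hs ->
  copies G (complete 2) = set0.
Proof.
move=> hF hI; apply/setP => M0; rewrite [RHS]inE; apply/negbTE/negP => M0c.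
have [[H0 K0] [[/= H0c K0c eM] uniqP]] := hI _ M0c.
have M0H0 : M0 \subset H0 by rewrite -eM subsetIl.
have [H1 [[H1c neH1 eH]] _] := hF _ _ H0c M0c M0H0.
have M0K0 : M0 \subset K0 by rewrite -eM subsetIr.
have M0H1 : M0 \subset H1 by rewrite -eH subsetIr.
suff eM1 : H1 :&: K0 = M0.
  have [eH01] : (H0, K0) = (H1, K0) by apply: uniqP.
  by rewrite eH01 eqxx in neH1.
move: K0c; rewrite !inE -[isomorphic _ _](in_set (fun S => isomorphic _ (induced S))).
case/andP=> K0c /negP nK0.
apply/esym/eqP; rewrite eqEcard subsetI M0H1 M0K0 /= (card_copy M0c) card_ord.
rewrite -ltnS -[3]card_ord -(card_copy (H := complete 3) K0c).
apply: proper_card; rewrite properE subsetIr subsetI subxx andbT.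
by apply/negP => sK0; apply: nK0; apply/existsP; exists H1; rewrite H1c.
Qed.

(* Hs is the family of induced subgraphs that play the role of "the copies of
   H" in G. Normally Hs = copies G H; it is a parameter because when K and H
   are isomorphic no copy of K lies outside all the copies of H, and the notion
   is then meaningful only after distinguishing some of the copies. *)
Definition coherent_UH (G H K M : sgraph) (Hs : {set {set G}}) : Prop :=
  [/\ [/\ induced_subgraph M H, subgraph M K & subgraph K H],
      UH G M /\ UH G H,
      Hs \subset copies G H,
      isos_extend (copies_outside K Hs)
    & meets_once K M Hs].

(* Main.v *)
(** Pairwise intersecting 2-subsets of a set either share a point or are the
    three 2-subsets of a 3-set, so the cliques of [L(K_n)] are the parts of the
    [n] stars and the [binom(n,3)] triangles. A bijection between two stars, or
    between two triangles, is induced by a partial injection of the points of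
    [K_n], which extends to a permutation, hence to an automorphism of [L(K_n)].
    For [n = 4] stars and triangles are both copies of [K_3], and the
    automorphism sending an edge of [K_4] to the complementary edge exchanges
    them. *)
Require Import Defs.
From mathcomp Require Import all_boot.
From mathcomp Require Import fingroup perm.
Set Implicit Arguments.
Unset Strict Implicit.
Unset Printing Implicit Defensive.

(** * Extension of partial injections to permutations *)

(** The hypothesis makes sending [k i] to [k' i] a well-defined injection. Induction along an
    enumeration of [A]: the permutation found for the tail is followed by a transposition that
    corrects the image of [k x]. *)
Lemma perm_extend (I T : finType) (k k' : I -> T) (A : {set I}) :
  {in A &, forall i j, (k i == k j) = (k' i == k' j)} ->
  exists s : {perm T}, {in A, forall i, s (k i) = k' i}.
Proof.
suff ext (l : seq I) : {in l &, forall i j, (k i == k j) = (k' i == k' j)} ->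
    exists s : {perm T}, {in l, forall i, s (k i) = k' i}.
  move=> kk'; have [|s sP] := ext (enum A).
    by move=> i j; rewrite !mem_enum; apply: kk'.
  by exists s => i iA; apply: sP; rewrite mem_enum.
elim: l => [|x l IH] kk'; first by exists 1%g.
have [|s sP] := IH.
  by move=> i j il jl; apply: kk'; rewrite inE ?il ?jl orbT.
exists (s * tperm (s (k x)) (k' x))%g => i il; rewrite permM.
have := kk' _ _ il (mem_head x l).
have [-> /esym/eqP -> | nk /esym/negbT nk'] := eqVneq (k i) (k x); first exact: tpermL.
have il' : i \in l.
  by move: il; rewrite inE => /predU1P[e|//]; rewrite e eqxx in nk.
(* Here [k' i] differs from [k' x] by hypothesis and from [s (k x)] by injectivity of [s], so the
   transposition fixes it. *)
rewrite -(sP _ il') tpermD ?(inj_eq perm_inj) 1?eq_sym //.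
by rewrite sP.
Qed.

(** * Cliques and copies of complete graphs *)

Definition clique (G : sgraph) (S : {set G}) : bool :=
  [forall x in S, forall y in S, (x != y) ==> adj x y].

Lemma cliqueP (G : sgraph) (S : {set G}) :
  reflect {in S &, forall x y, x != y -> adj x y} (clique S).
Proof.
apply: (iffP forall_inP) => [cS x y xS yS | cS x xS].
  by move/forall_inP: (cS _ xS) => /(_ _ yS) /implyP.
by apply/forall_inP => y yS; apply/implyP; apply: cS.
Qed.

Lemma in_copies_complete (G : sgraph) m (S : {set G}) :
  (S \in copies G (complete m)) = (#|S| == m) && clique S.
Proof.
apply/idP/andP => [SC | [/eqP cS /cliqueP kS]].
  split; first by rewrite (card_copy SC) card_ord.
  move: SC; rewrite inE => /isomorphicP[f [[g fK gK] fm]].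
  apply/cliqueP => x y xS yS nxy.
  have := fm (g (exist _ x xS)) (g (exist _ y yS)); rewrite !gK /= /induced_adj /= => ->.
  by rewrite /complete_adj /= (can_eq gK) -val_eqE.
rewrite inE; apply/isomorphicP.
have im (i : 'I_m) : enum_val (cast_ord (esym cS) i) \in S by apply: enum_valP.
exists (fun i : complete m => exist (fun x : G => x \in S) _ (im i) : induced S); split; last first.
  move=> i j; rewrite /= /complete_adj /induced_adj /=.
  have [-> | nij] := eqVneq i j; first exact: adj_irrefl.
  apply: kS => //; apply: contraNneq nij => /enum_val_inj/cast_ord_inj -> //.
apply: inj_card_bij => [i j /(congr1 val) /= /enum_val_inj/cast_ord_inj //|].
by rewrite card_sig card_ord -cS; apply: eq_leq; apply: eq_card => x; rewrite !inE.
Qed.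

(** Trades maps between the sigma types [induced S] and [induced T] for functions on all of [G].
    Between cliques, an injective map is all the information an isomorphism carries. *)
Lemma isos_extend_fun (G : sgraph) (F : {set {set G}}) :
  (forall (S T : {set G}) (h : G -> G), S \in F -> T \in F ->
     {in S &, injective h} -> {in S, forall x, h x \in T} ->
     exists phi : G -> G, isomorphism phi /\ {in S, phi =1 h}) ->
  isos_extend F.
Proof.
move=> ext S T SF TF g [/bij_inj gi _].
pose h (x : G) : G :=
  (* The value outside [S] is an arbitrary default. *)
  if insub x : option {x | x \in S} is Some y then val (g y) else x.
have hE (y : induced S) : h (val y) = val (g y) by rewrite /h valK.
have [||phi [phiA phiE]] := ext S T h SF TF.
- move=> x y xS yS; rewrite (hE (exist _ x xS)) (hE (exist _ y yS)).
  by move/val_inj/gi => [].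
- by move=> x xS; rewrite (hE (exist _ x xS)); apply: valP.
by exists phi; split=> // x; rewrite phiE ?hE //; apply: valP.
Qed.

Lemma isomorphism_comp (G1 G2 G3 : sgraph) (f : G2 -> G3) (g : G1 -> G2) :
  isomorphism f -> isomorphism g -> isomorphism (f \o g).
Proof.
by move=> [fb fm] [gb gm]; split=> [|x y /=]; [apply: bij_comp | rewrite fm gm].
Qed.

Lemma isomorphism_id (G : sgraph) : isomorphism (@id G).
Proof. by split=> //; exists id. Qed.

(** * Vertices of [L(K_n)] as 2-subsets, and automorphisms from set maps *)

Section LineComplete.
Variable n : nat.
Local Notation G := (line_graph (complete n)).
Implicit Types (a b x y : 'I_n) (e f : G) (S T : {set G}) (V W : {set 'I_n}).

Definition ends e : {set 'I_n} := val e.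

Lemma ends_inj : injective ends. Proof. exact: val_inj. Qed.

Lemma in_edges_complete V : (V \in edges (complete n)) = (#|V| == 2).
Proof.
rewrite inE; apply/existsP/cards2P => [[x /existsP[y /andP[xy /eqP eV]]]|].
  by exists x, y.
by case=> x [y [xy eV]]; exists x; apply/existsP; exists y; apply/andP; split=> //; apply/eqP.
Qed.

Lemma card_ends e : #|ends e| = 2.
Proof. by apply/eqP; rewrite -in_edges_complete; apply: (valP e). Qed.

Lemma ends_ex V : #|V| = 2 -> exists e, ends e = V.
Proof.
by move/eqP; rewrite -in_edges_complete => VE; exists (exist _ V VE).
Qed.

Lemma ends_ex2 x y : x != y -> exists e, ends e = [set x; y].
Proof. by move=> xy; apply: ends_ex; rewrite cards2 xy. Qed.

Lemma adjE e f : adj e f = (e != f) && (ends e :&: ends f != set0).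
Proof. by []. Qed.

Lemma ends_star a e : a \in ends e -> exists2 x, x != a & ends e = [set a; x].
Proof.
move=> ae; have /eqP/cards1P[x ex] : #|ends e :\ a| = 1.
  by have := cardsD1 a (ends e); rewrite ae card_ends => -[].
exists x; last by rewrite -ex setD1K.
by have := set11 x; rewrite -ex !inE => /andP[].
Qed.

Lemma ends_eqP x y e : x != y -> x \in ends e -> y \in ends e -> ends e = [set x; y].
Proof.
move=> xy xe ye; apply/esym/eqP; rewrite eqEcard card_ends cards2 xy andbT.
by apply/subsetP => z; rewrite !inE => /pred2P[] ->.
Qed.

(** Adjacency of 2-subsets only involves being distinct and meeting, and [p] respects both. This
    covers images under permutations of the points as well as complementation when [n = 4]. *)
Lemma set_map_isomorphism (p : {set 'I_n} -> {set 'I_n}) :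
  injective p -> (forall V, #|V| = 2 -> #|p V| = 2) ->
  (forall V W, #|V| = 2 -> #|W| = 2 ->
     (p V :&: p W == set0) = (V :&: W == set0)) ->
  exists phi : G -> G, isomorphism phi /\ forall e, ends (phi e) = p (ends e).
Proof.
move=> pi p2 pI.
have /fin_all_exists[phi phiE] e : exists f, ends f = p (ends e).
  by apply: ends_ex; rewrite p2 ?card_ends.
have phii : injective phi.
  by move=> e f /(congr1 ends); rewrite !phiE => /pi/ends_inj.
exists phi; split=> //; split; first exact: injF_bij.
by move=> e f; rewrite !adjE (inj_eq phii) !phiE pI ?card_ends.
Qed.

Lemma perm_isomorphism (s : {perm 'I_n}) :
  exists phi : G -> G, isomorphism phi /\ forall e, ends (phi e) = s @: ends e.
Proof.
apply: (@set_map_isomorphism (fun V => s @: V)).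
- exact/imset_inj/perm_inj.
- by move=> V; rewrite card_imset //; apply: perm_inj.
by move=> V W _ _; rewrite -imsetI ?imset_eq0 // => x y _ _; apply: perm_inj.
Qed.

(** * Extending injections of stars and of triangles *)

Definition star a : {set G} := [set e | a \in ends e].
Definition triangle V : {set G} := [set e | ends e \subset V].

(** An edge of a star is determined by its endpoint other than the centre, so [h] amounts to a
    partial injection of points. Allowing any part [S] of the star handles all clique sizes at
    once. *)
Lemma star_extend a a' S (h : G -> G) :
  {in S &, injective h} -> S \subset star a ->
  {in S, forall e, h e \in star a'} ->
  exists phi : G -> G, isomorphism phi /\ {in S, phi =1 h}.
Proof.
move=> hi /subsetP Sa ha'.
have otherP b : exists k : G -> 'I_n,
    forall e, b \in ends e -> k e != b /\ ends e = [set b; k e].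
  apply: (@fin_all_exists G (fun=> 'I_n)
    (fun e x => b \in ends e -> x != b /\ ends e = [set b; x])) => e.
  case: (boolP (b \in ends e)) => [|_]; last by exists b.
  by case/ends_star=> x xb ex; exists x.
have [[k kP] [k' k'P]] := (otherP a, otherP a').
have {kP}kP e : e \in S -> k e != a /\ ends e = [set a; k e].
  by move/Sa; rewrite inE => /kP.
have {k'P}k'P e : e \in S -> k' (h e) != a' /\ ends (h e) = [set a'; k' (h e)].
  by move/ha'; rewrite inE => /k'P.
have [|s sP] := @perm_extend _ _ k (k' \o h) S.
  move=> e f eS fS /=; apply/eqP/eqP => [kef | kef].
    suff -> : e = f by [].
    by apply: ends_inj; rewrite (proj2 (kP e eS)) kef -(proj2 (kP f fS)).
  suff -> : e = f by [].
  apply: hi => //.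
  by apply: ends_inj; rewrite (proj2 (k'P e eS)) kef -(proj2 (k'P f fS)).
(* The transposition sends the centre to [a']. It fixes each [k' (h e)], which differs from [a']
   and, since [k e != a], also from [s a]. *)
have [phi [phiA phiE]] := perm_isomorphism (s * tperm (s a) a')%g.
exists phi; split=> // e eS; apply: ends_inj; rewrite phiE.
have [ka ke] := kP _ eS; have [ka' ke'] := k'P _ eS.
rewrite ke ke' imsetU1 imset_set1 !permM tpermL (sP _ eS) /= tpermD // 1?eq_sym //.
by rewrite -[k' _](sP _ eS) (inj_eq perm_inj).
Qed.

(** An edge of a triangle is determined by the opposite point, so [h] amounts to a map of opposite
    points from [V] to [V']. *)
Lemma triangle_extend V V' (h : G -> G) :
  #|V| = 3 -> #|V'| = 3 ->
  {in triangle V &, injective h} ->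
  {in triangle V, forall e, h e \in triangle V'} ->
  exists phi : G -> G, isomorphism phi /\ {in triangle V, phi =1 h}.
Proof.
move=> V3 V'3 hi hV'.
have oppP W : #|W| = 3 -> exists k : G -> 'I_n,
    forall e, ends e \subset W -> k e \in W /\ ends e = W :\ k e.
  move=> W3; apply: (@fin_all_exists G (fun=> 'I_n)
    (fun e x => ends e \subset W -> x \in W /\ ends e = W :\ x)) => e.
  (* A default value for the edges not inside [W]. *)
  have [x0 _] : exists x, x \in W by apply/card_gt0P; rewrite W3.
  case: (boolP (ends e \subset W)) => [eW|_]; last by exists x0.
  have /eqP/cards1P[x ex] : #|W :\: ends e| = 1.
    by rewrite cardsD (setIidPr eW) W3 card_ends.
  exists x => _; rewrite -ex setDDr setDv set0U (setIidPr eW); split=> //.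
  by have := set11 x; rewrite -ex inE => /andP[].
have [[k kP] [k' k'P]] := (oppP _ V3, oppP _ V'3).
have {kP}kP e : e \in triangle V -> k e \in V /\ ends e = V :\ k e.
  by rewrite inE => /kP.
have {k'P}k'P e : e \in triangle V -> k' (h e) \in V' /\ ends (h e) = V' :\ k' (h e).
  by move/hV'; rewrite inE => /k'P.
have [|s sP] := @perm_extend _ _ k (k' \o h) (triangle V).
  move=> e f eS fS /=; apply/eqP/eqP => [kef | kef].
    suff -> : e = f by [].
    by apply: ends_inj; rewrite (proj2 (kP e eS)) kef -(proj2 (kP f fS)).
  suff -> : e = f by [].
  apply: hi => //.
  by apply: ends_inj; rewrite (proj2 (k'P e eS)) kef -(proj2 (k'P f fS)).
(* Each [x] in [V] is opposite to the edge [V :\ x], so [s x] is a point of [V']; equal sizes do the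
   rest. *)
have sV : s @: V = V'.
  apply/eqP; rewrite eqEcard (card_imset _ perm_inj) V3 V'3 leqnn andbT.
  apply/subsetP => _ /imsetP[x xV ->].
  have [|e eE] := @ends_ex (V :\ x).
    by have := cardsD1 x V; rewrite xV V3 => -[].
  have eV : e \in triangle V by rewrite inE eE subD1set.
  suff <- : k e = x by rewrite (sP _ eV) /=; have [] := k'P _ eV.
  have [keV] := kP _ eV; rewrite eE => /setP/(_ (k e)).
  by rewrite !inE eqxx keV andbT => /negbFE/eqP.
have [phi [phiA phiE]] := perm_isomorphism s.
exists phi; split=> // e eS; apply: ends_inj; rewrite phiE.
have [_ ->] := kP _ eS; have [_ ->] := k'P _ eS.
have /= <- := sP _ eS; rewrite -sV; apply/setP => y; rewrite -[y](permKV s).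
by rewrite !(inE, mem_imset _ _ perm_inj) (inj_eq perm_inj).
Qed.

(** * Classification of the cliques of [L(K_n)] *)

Lemma clique_meet S e f : clique S -> e \in S -> f \in S ->
  exists2 x, x \in ends e & x \in ends f.
Proof.
move=> /cliqueP cS eS fS; have [<- | ef] := eqVneq e f.
  have /card_gt0P[x xe] : 0 < #|ends e| by rewrite card_ends.
  by exists x.
have := cS _ _ eS fS ef; rewrite adjE => /andP[_ /set0Pn[x]].
by rewrite inE => /andP[xe xf]; exists x.
Qed.

(** Without a common point, an edge [e0 = ab] of [S] comes with an [e1] missing [a] and an [e2]
    missing [b]. Pairwise meeting forces [e1 = bc] and [e2 = ac] for some [c], and [S] is then the
    triangle on [a], [b], [c]. *)
Lemma clique_star_or_triangle S : clique S -> S != set0 ->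
  (exists a, S \subset star a) \/ (exists2 V : {set 'I_n}, #|V| = 3 & S = triangle V).
Proof.
move=> cS /set0Pn[e0 e0S].
case: (boolP [exists a, S \subset star a]) => [/existsP|/existsPn nstar]; first by left.
right.
have miss x : exists2 e, e \in S & x \notin ends e.
  by have /subsetPn[e eS] := nstar x; rewrite inE => xe; exists e.
have /eqP/cards2P[a [b [ab e0E]]] := card_ends e0.
have [e1 e1S ae1] := miss a; have [e2 e2S be2] := miss b.
have be1 : b \in ends e1.
  have [x] := clique_meet cS e0S e1S; rewrite e0E !inE => /pred2P[]-> //.
  by rewrite (negbTE ae1).
have ae2 : a \in ends e2.
  have [x] := clique_meet cS e0S e2S; rewrite e0E !inE => /pred2P[]-> //.
  by rewrite (negbTE be2).
have [c ce1 ce2] := clique_meet cS e1S e2S.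
have ac : a != c by apply: contraNneq ae1 => ->.
have bc : b != c by apply: contraNneq be2 => ->.
have e1E := ends_eqP bc be1 ce1; have e2E := ends_eqP ac ae2 ce2.
exists [set a; b; c].
  by rewrite setUC cardsU1 cards2 ab !inE negb_or eq_sym ac eq_sym bc.
apply/setP => e; rewrite inE; apply/idP/idP => [eS | eV].
  apply/subsetP => x xe; rewrite !inE.
  have [y0 y0e0 y0e] := clique_meet cS e0S eS.
  have [y1 y1e1 y1e] := clique_meet cS e1S eS.
  have [y2 y2e2 y2e] := clique_meet cS e2S eS.
  move: y0e0 y1e1 y2e2; rewrite e0E e1E e2E !inE => y0E y1E y2E.
  (* If [x] were outside [{a, b, c}], the other endpoint [y] of [e] would lie on [e0], [e1] and
     [e2], which have no common point. *)
  have [//|] := boolP (_ || _); rewrite !negb_or -andbA => /and3P[xa xb xc].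
  have [y yx eE] := ends_star xe.
  have yE z : z \in ends e -> z != x -> z = y.
    by rewrite eE !inE => /orP[/eqP->|/eqP//]; rewrite eqxx.
  have y0y : y0 = y by apply: yE => //; case/pred2P: y0E => ->; rewrite eq_sym.
  have y1y : y1 = y by apply: yE => //; case/pred2P: y1E => ->; rewrite eq_sym.
  have y2y : y2 = y by apply: yE => //; case/pred2P: y2E => ->; rewrite eq_sym.
  move: y0E y1E y2E; rewrite y0y y1y y2y => /pred2P[]->.
    by rewrite (negbTE ab) (negbTE ac).
  by rewrite eqxx /= eq_sym (negbTE ab) (negbTE bc).
(* Conversely, two distinct points among [a], [b], [c] span one of [e0], [e1], [e2], all in [S]. *)
have /eqP/cards2P[x [y [xy eE]]] := card_ends e.
suff : [|| ends e == ends e0, ends e == ends e1 | ends e == ends e2].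
  by case/or3P=> /eqP/ends_inj->.
have sub1 : x \in [set a; b; c] by apply: (subsetP eV); rewrite eE set21.
have sub2 : y \in [set a; b; c] by apply: (subsetP eV); rewrite eE set22.
rewrite eE e0E e1E e2E.
move: sub1 sub2 xy; rewrite !inE -!orbA.
by case/or3P=> /eqP-> /or3P[]/eqP->;
   rewrite ?[[set b; a]]setUC ?[[set c; a]]setUC ?[[set c; b]]setUC ?eqxx ?orbT.
Qed.

Lemma clique_star S a : S \subset star a -> clique S.
Proof.
move=> /subsetP Sa; apply/cliqueP => e f eS fS ef; rewrite adjE ef.
apply/set0Pn; exists a.
by have := Sa _ eS; have := Sa _ fS; rewrite !inE => -> ->.
Qed.

Lemma clique_triangle V : #|V| = 3 -> clique (triangle V).
Proof.
move=> V3; apply/cliqueP => e f; rewrite !inE => eV fV ef; rewrite adjE ef /=.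
(* Disjoint edges would put four points into [V]. *)
apply: contraTneq (subset_leq_card (_ : ends e :|: ends f \subset V)) => [I0|].
  by rewrite cardsU I0 cards0 !card_ends V3.
by rewrite subUset eV.
Qed.

(** * Counting stars and triangles, and matching them with copies *)

Lemma card_triangle V : #|V| = 3 -> #|triangle V| = 3.
Proof.
move=> V3; rewrite -(card_imset _ ends_inj) -[RHS]/('C(3, 2)) -V3 -cards_draws.
apply: eq_card => W; rewrite !inE; apply/imsetP/andP => [[e]|[WV /eqP W2]].
  by rewrite inE => eV ->; rewrite card_ends.
by have [e eW] := ends_ex W2; exists e; rewrite ?inE eW.
Qed.

Lemma card_star a : #|star a| = n.-1.
Proof.
rewrite -(card_imset _ ends_inj).
have -> : ends @: star a = (fun x => [set a; x]) @: [set~ a].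
  apply/setP => W; apply/imsetP/imsetP => [[e]|[x]].
    by rewrite inE => /ends_star[x xa eE] ->; exists x; rewrite ?inE.
  rewrite !inE eq_sym => /ends_ex2[e eE] ->.
  by exists e; rewrite ?inE eE ?set21.
rewrite card_in_imset ?cardsC1 ?card_ord // => x y; rewrite !inE => xa ya.
by move/setP/(_ x); rewrite !inE eqxx orbT (negbTE xa) => /esym/eqP.
Qed.

(** Two points of [V] other than [a] span an edge of the triangle that misses [a]. *)
Lemma triangle_not_star V a : #|V| = 3 -> ~~ (triangle V \subset star a).
Proof.
move=> V3; have : 1 < #|V :\ a|.
  by rewrite -(ltn_add2l (a \in V)) -cardsD1 V3; case: (a \in V).
case/card_gt1P=> x [y []]; rewrite !inE => /andP[xa xV] /andP[ya yV] xy.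
have [e eE] := ends_ex2 xy; apply/subsetPn; exists e; rewrite inE eE.
  by apply/subsetP => z; rewrite !inE => /pred2P[]->.
by rewrite !inE ![a == _]eq_sym negb_or xa.
Qed.

Lemma triangle_inj : {in [set V : {set 'I_n} | #|V| == 3] &, injective triangle}.
Proof.
move=> V W; rewrite !inE => /eqP V3 /eqP W3 VW.
apply/eqP; rewrite eqEcard V3 W3 leqnn andbT; apply/subsetP => x xV.
have /card_gt0P[y] : 0 < #|V :\ x| by rewrite -(ltn_add2l (x \in V)) -cardsD1 V3 xV.
rewrite !inE eq_sym => /andP[/ends_ex2[e eE] yV].
have : e \in triangle W.
  by rewrite -VW inE eE; apply/subsetP => z; rewrite !inE => /pred2P[]->.
by rewrite inE eE => /subsetP; apply; rewrite set21.
Qed.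

(** The distinguished copies of [K_{n-1}]: all of them when [n > 4], and four of the eight copies of
    [K_3] when [n = 4]. *)
Definition stars : {set {set G}} := [set star a | a in 'I_n].

Lemma card_stars : 2 < n -> #|stars| = n.
Proof.
move=> n2; rewrite card_imset ?card_ord // => a b ab.
apply/eqP/negP => /negP nab.
(* A third point [c] gives the edge [ca], which lies in [star a] but not in [star b]. *)
have /card_gt0P[c] : 0 < #|~: [set a; b]|.
  by rewrite cardsCs setCK card_ord cards2 nab subn_gt0.
rewrite !inE negb_or => /andP[ca cb].
have [e eE] := ends_ex2 ca.
have : e \in star b by rewrite -ab inE eE set22.
by rewrite inE eE !inE ![b == _]eq_sym (negbTE cb) (negbTE nab).
Qed.

Lemma copies_outside_stars :
  copies_outside (complete 3) stars = triangle @: [set V : {set 'I_n} | #|V| == 3].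
Proof.
apply/setP => S; rewrite inE in_copies_complete.
apply/andP/imsetP => [[/andP[/eqP S3 cS] nS]|[V + ->]].
  have [|[a Sa]|[V V3 ->]] := clique_star_or_triangle cS.
  - by rewrite -card_gt0 S3.
  - by case/negP: nS; apply/existsP; exists (star a); rewrite imset_f.
  by exists V; rewrite ?inE ?V3.
rewrite inE => /eqP V3; rewrite card_triangle // clique_triangle //; split=> //.
apply/existsP => -[_ /andP[/imsetP[a _ ->]]].
exact/negP/triangle_not_star.
Qed.

Lemma stars_copies : stars \subset copies G (complete n.-1).
Proof.
apply/subsetP => _ /imsetP[a _ ->].
by rewrite in_copies_complete card_star eqxx (@clique_star _ a).
Qed.

Lemma clique_sub_star S : clique S -> S != set0 -> #|S| != 3 ->
  exists a, S \subset star a.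
Proof.
move=> cS S0 S3; have [//|[V V3 SV]] := clique_star_or_triangle cS S0.
by rewrite SV card_triangle in S3.
Qed.

(** As [n - 1 > 3], a clique of this size is no triangle; it lies in a star and fills it by
    cardinality. *)
Lemma copies_stars : 4 < n -> copies G (complete n.-1) = stars.
Proof.
move=> n4; apply/eqP; rewrite eqEsubset stars_copies andbT.
apply/subsetP => S; rewrite in_copies_complete => /andP[/eqP Sn cS].
have n1 : 3 < n.-1 by case: (n) n4.
have [||a Sa] := clique_sub_star cS.
- by rewrite -card_gt0 Sn (leq_trans _ n1).
- by rewrite Sn gtn_eqF.
suff -> : S = star a by apply: imset_f.
by apply/eqP; rewrite eqEcard Sa card_star Sn leqnn.
Qed.

(** * Ultrahomogeneity for complete graphs *)

Lemma UH_complete m : 0 < m -> m != 3 -> UH G (complete m).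
Proof.
move=> m0 m3; apply: isos_extend_fun => S T h.
rewrite !in_copies_complete => /andP[/eqP Sm cS] /andP[/eqP Tm cT] hi hT.
have [||a Sa] := clique_sub_star cS; rewrite -?card_gt0 ?Sm //.
have [||b Tb] := clique_sub_star cT; rewrite -?card_gt0 ?Tm //.
by apply: star_extend hi Sa _ => e eS; apply: (subsetP Tb) (hT _ eS).
Qed.

Lemma complement_isomorphism : n = 4 ->
  exists u : G -> G, [/\ isomorphism u, involutive u
                       & forall e, ends (u e) = ~: ends e].
Proof.
move=> n4; have cC V : #|V| = 2 -> #|~: V| = 2.
  by move=> V2; rewrite cardsCs setCK card_ord V2 n4.
have [|||u [uA uE]] := @set_map_isomorphism (@setC _).
- exact: setC_inj.
- exact: cC.
(* The complements meet in [4 - #|V :|: W|] points, that is, in as many points as [V] and [W] do. *)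
- move=> V W V2 W2; rewrite -setCU -!cards_eq0 cardsCs setCK card_ord [X in X - _]n4.
  rewrite cardsU V2 W2 addnn subKn //.
  by rewrite (leq_trans (subset_leq_card (subsetIl V W))) ?V2.
exists u; split=> // e; apply: ends_inj; rewrite !uE setCK //.
Qed.

(** Complementation turns the triangle on [V] into the star of the point missing from [V]. Moving
    source and target into stars this way, by involutions [u] and [v], reduces the extension of [h]
    to that of [v \o h \o u] between stars. *)
Lemma UH_complete3 : n = 4 -> UH G (complete 3).
Proof.
move=> n4; have [c [cA cK cE]] := complement_isomorphism n4.
have toStar S : S \in copies G (complete 3) -> exists u : G -> G,
    [/\ isomorphism u, involutive u & exists a, {in S, forall e, u e \in star a}].
  rewrite in_copies_complete => /andP[/eqP S3 cS].
  have [|[a /subsetP Sa]|[V V3 SV]] := clique_star_or_triangle cS.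
  - by rewrite -card_gt0 S3.
  - by exists id; split=> //; [apply: isomorphism_id | exists a].
  exists c; split=> //.
  have /eqP/cards1P[a Va] : #|~: V| = 1 by rewrite cardsCs setCK card_ord V3 n4.
  exists a => e; rewrite SV !inE cE inE => eV.
  apply/negP => /(subsetP eV); have := set11 a.
  by rewrite -Va inE => /negbTE->.
apply: isos_extend_fun => S T h /toStar[u [uA uK [a Sa]]] /toStar[v [vA vK [b Tb]]] hi hT.
have [|||phi [phiA phiE]] := @star_extend a b (u @: S) (v \o h \o u).
- move=> _ _ /imsetP[e eS ->] /imsetP[f fS ->] /=; rewrite !uK.
  by move/(can_inj vK)/hi => ->.
- by apply/subsetP => _ /imsetP[e eS ->]; apply: Sa.
- by move=> _ /imsetP[e eS ->]; rewrite /= uK; apply/Tb/hT.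
exists (v \o phi \o u); split.
  by apply: isomorphism_comp => //; apply: isomorphism_comp.
by move=> e eS; rewrite /= phiE ?imset_f //= uK vK.
Qed.

(** * Triangles as the outside copies of [K_3], and their intersections with stars *)

Lemma isos_extend_triangles : isos_extend (copies_outside (complete 3) stars).
Proof.
rewrite copies_outside_stars; apply: isos_extend_fun => S T h.
move=> /imsetP[V + ->] /imsetP[W + ->]; rewrite !inE => /eqP V3 /eqP W3.
exact: triangle_extend.
Qed.

Lemma meets_once_stars : meets_once (complete 3) (complete 2) stars.
Proof.
move=> M; rewrite in_copies_complete copies_outside_stars => /andP[/cards2P[e [f [ef ->]]]].
move/cliqueP/(_ _ _ (set21 e f) (set22 e f) ef); rewrite adjE => /andP[_ /set0Pn[a]].
rewrite inE => /andP[ae af].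
have [x xa eE] := ends_star ae; have [y ya fE] := ends_star af.
have xy : x != y by apply: contraNneq ef => xy; apply/eqP/ends_inj; rewrite eE fE xy.
have cardV : #|ends e :|: ends f| = 3.
  have -> : ends e :|: ends f = a |: [set x; y].
    by rewrite eE fE setUACA setUid.
  by rewrite cardsU1 cards2 xy !inE ![a == _]eq_sym negb_or xa ya.
(* With [e = ax] and [f = ay], the pair is the star of the common point and the triangle on [a],
   [x], [y]. An edge [az] of that triangle has [z = x] or [z = y], hence is [e] or [f]. *)
exists (star a, triangle (ends e :|: ends f)); split=> /=.
  split; first exact: imset_f.
    by apply: imset_f; rewrite inE cardV.
  apply/setP => g; rewrite !inE; apply/andP/pred2P => [[ag]|[]->]; last 2 first.
  - by rewrite subsetUl.
  - by rewrite subsetUr.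
  have [z za gE] := ends_star ag; rewrite gE => /subsetP/(_ z (set22 _ _)).
  rewrite eE fE !inE (negbTE za) /= => /orP[]/eqP ze; [left | right];
    by apply: ends_inj; rewrite gE ze.
(* Uniqueness: a centre [b] other than [a] would give [e = f = ab], and the 3-set [W] contains the
   three points of [e] and [f]. *)
case=> _ _ [/= /imsetP[b _ ->] /imsetP[W + ->]]; rewrite inE => /eqP W3 eM.
have : e \in star b :&: triangle W by rewrite eM set21.
have : f \in star b :&: triangle W by rewrite eM set22.
rewrite !inE => /andP[bf fW] /andP[be eW]; congr (star _, triangle _).
  apply/eqP/negPn/negP => nab; case/negP: ef; apply/eqP/ends_inj.
  by rewrite (ends_eqP nab ae be) (ends_eqP nab af bf).
by apply/eqP; rewrite eqEcard subUset eW fW cardV W3.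
Qed.

End LineComplete.

(** * Inclusions among complete graphs, and assembly *)

Lemma induced_subgraph_complete m k :
  m <= k -> induced_subgraph (complete m) (complete k).
Proof.
move=> mk; exists (widen_ord mk); split=> [x y /(congr1 val) /= /val_inj //|x y].
by rewrite /= /complete_adj /= -!val_eqE.
Qed.

Lemma induced_subgraphW (G1 G2 : sgraph) :
  induced_subgraph G1 G2 -> subgraph G1 G2.
Proof. by case=> f [fi fm]; exists f; split=> // x y; rewrite fm. Qed.

Theorem theorem4 (n : nat) (hn : 4 <= n) :
  exists Hs : {set {set line_graph (complete n)}},
    [/\ 5 <= n -> Hs = copies (line_graph (complete n)) (complete n.-1),
        coherent_UH (complete n.-1) (complete 3) (complete 2) Hs,
        #|Hs| = n
      & #|copies_outside (complete 3) Hs| = 'C(n, 3)].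
Proof.
have n3 : 3 <= n.-1 by case: n hn.
exists (stars n); split.
- by move/copies_stars.
- split.
  + split; first by apply: induced_subgraph_complete; apply: leq_trans n3.
      exact/induced_subgraphW/induced_subgraph_complete.
    exact/induced_subgraphW/induced_subgraph_complete.
  + split; first exact: UH_complete.
    (* Size 3 arises here only for [n = 4], where complementation is required. *)
    have [n4|n4] := eqVneq n.-1 3.
      by rewrite n4; apply: UH_complete3; case: n n4 hn {n3} => // m /= ->.
    by apply: UH_complete => //; apply: leq_trans n3.
  + exact: stars_copies.
  + exact: isos_extend_triangles.
  + exact: meets_once_stars.
- by rewrite card_stars // ltnW.
rewrite copies_outside_stars card_in_imset; last exact: triangle_inj.
by rewrite card_draws card_ord.
Qed.
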